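(* Let $x_1,x_2,\dots,x_n$ be $n$ positive real numbers, with arithmetic mean $A$, geometric mean $G$ and harmonic mean $H$. Then $$H\leq H\left(\frac{A}{H}\right)^{\frac1n}\leq G\leq \left(\frac{H}{A}\right)^{\frac1n}A\leq A.$$
   Context: For positive real numbers $x_1,\dots,x_n$: $A=\frac1n\sum_{i=1}^n x_i$, $G=\left(\prod_{i=1}^n x_i\right)^{1/n}$, $H=\left(\frac1n\sum_{i=1}^n\frac1{x_i}\right)^{-1}$. *)

(* Defs.v *)
From mathcomp Require Import all_boot all_order all_algebra.
From mathcomp Require Import reals exp.

Set Implicit Arguments.
Unset Strict Implicit.
Unset Printing Implicit Defensive.

Import Order.TTheory GRing.Theory Num.Theory.
Local Open Scope ring_scope.

Definition arith_mean (R : realType) (n : nat) (x : 'I_n -> R) : R :=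
  n%:R^-1 * \sum_(i < n) x i.

Definition geom_mean (R : realType) (n : nat) (x : 'I_n -> R) : R :=
  (\prod_(i < n) x i) `^ n%:R^-1.

Definition harm_mean (R : realType) (n : nat) (x : 'I_n -> R) : R :=
  (n%:R^-1 * \sum_(i < n) (x i)^-1)^-1.

(* Main.v *)
Require Import Defs.
From mathcomp Require Import all_boot all_order all_algebra.
From mathcomp Require Import reals exp.
From mathcomp Require Import ring.

(* Since the product over H is the mean of the products omitting one variable,
   the third inequality is the Maclaurin inequality comparing that mean with
   A^(n-1), which follows from AM-GM by induction on n. The second inequality is
   the third one for the inverses of the variables. *)

Set Implicit Arguments.
Unset Strict Implicit.
Unset Printing Implicit Defensive.

Import Order.TTheory GRing.Theory Num.Theory.
Local Open Scope ring_scope.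

(** AM-GM for [m] copies of [s] and a single [t]. *)
Lemma prod_powS_le_mean (R : realFieldType) (m : nat) (s t : R) :
  0 <= s -> 0 <= t -> s ^+ m * t <= ((m%:R * s + t) / m.+1%:R) ^+ m.+1.
Proof.
(* The odd value [t] sits at the last index, where [big_ord_recr] splits it off. *)
move=> s0 t0; pose E (i : 'I_m.+1) := if i == ord_max then t else s.
have E0 : {in 'I_m.+1, forall i, 0 <= E i} by move=> i _; rewrite /E; case: ifP.
have Ew (i : 'I_m) : E (widen_ord (leqnSn m) i) = s.
  by rewrite /E -val_eqE /= (ltn_eqF (ltn_ord i)).
have Em : E ord_max = t by rewrite /E eqxx.
have /leifP := leif_AGM E0; rewrite card_ord.
have -> : \prod_(i in 'I_m.+1) E i = s ^+ m * t.
  rewrite big_ord_recr /= Em; under eq_bigr do rewrite Ew.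
  by rewrite prodr_const card_ord.
have -> : \sum_(i in 'I_m.+1) E i = m%:R * s + t.
  rewrite big_ord_recr /= Em; under eq_bigr do rewrite Ew.
  by rewrite sumr_const card_ord mulr_natl.
by case: ifP => _ => [/eqP -> // | /ltW].
Qed.

Lemma prod_le_mean_exp (R : realFieldType) (n : nat) (x : 'I_n -> R) :
  (forall i, 0 < x i) -> \prod_(i < n) x i <= (n%:R^-1 * \sum_(i < n) x i) ^+ n.
Proof.
move=> x0; have x0' : {in 'I_n, forall i, 0 <= x i} by move=> i _; exact: ltW.
by have [+ _] := leif_AGM x0'; rewrite card_ord [X in X ^+ _]mulrC.
Qed.

(* The left-hand side is the elementary symmetric polynomial of degree m in
   m+1 variables. Adjoining a variable y to variables of mean s turns the bound
   into s^m (s + (m+1) y) <= (m+2) s'^(m+1), with s' the new mean: this is AM-GM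
   for m copies of s and one of (s + (m+1) y) / (m+2). *)
Lemma prod_sum_inv_le (R : realFieldType) (m : nat) (x : 'I_m.+1 -> R) :
  (forall i, 0 < x i) ->
  \prod_(i < m.+1) x i * \sum_(i < m.+1) (x i)^-1
    <= m.+1%:R * (m.+1%:R^-1 * \sum_(i < m.+1) x i) ^+ m.
Proof.
elim: m x => [|m IH] x x0.
  by rewrite !big_ord1 expr0 mulr1 divff // gt_eqF.
pose z i := x (widen_ord (leqnSn m.+1) i).
have z0 i : 0 < z i by exact: x0.
rewrite !(big_ord_recr m.+1) /= -/z.
set y := x ord_max; have y0 : 0 < y by exact: x0.
have := IH z z0; have := prod_le_mean_exp z0.
have : 0 < \sum_(i < m.+1) z i.
  by rewrite big_ord_recl ltr_pwDl // sumr_ge0 // => i _; exact: ltW.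
set P := \prod_(i < m.+1) z i; set S := \sum_(i < m.+1) z i.
set T := \sum_(i < m.+1) (z i)^-1 => S0 leP leT.
rewrite -/P -/S -/T.
set s := m.+1%:R^-1 * S in leP leT.
have n0 : 0 < m.+1%:R :> R by rewrite ltr0n.
have n1 : 0 < m.+2%:R :> R by rewrite ltr0n.
have s0 : 0 < s by rewrite mulr_gt0 ?invr_gt0.
have -> : P * y * (T + y^-1) = P * T * y + P.
  by rewrite mulrDr mulfK ?gt_eqF //; ring.
(* The induction hypothesis bounds [P * T] and AM-GM bounds [P]; the middle term is
   [s^m (s + (m+1) y)]. *)
apply: (@le_trans _ _ (m.+1%:R * s ^+ m * y + s ^+ m.+1)).
  by rewrite lerD // ler_pM2r.
have t0 : 0 <= (s + m.+1%:R * y) / m.+2%:R.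
  by apply: divr_ge0 => //; apply: addr_ge0; [|apply: mulr_ge0 => //]; exact: ltW.
have := prod_powS_le_mean m (ltW s0) t0.
(* Since [S = (m+1) s], the mean of [m] copies of [s] and this fraction is exactly the mean of all
   [m+2] variables. *)
have -> : (m%:R * s + (s + m.+1%:R * y) / m.+2%:R) / m.+1%:R
        = m.+2%:R^-1 * (S + y).
  have -> : S = m.+1%:R * s by rewrite /s mulVKf ?gt_eqF.
  by field; rewrite -(natrD R 2 m) -(natrD R 1 m) !pnatr_eq0.
rewrite -(ler_pM2l n1); apply: le_trans.
(* The factor [m+2] cancels the denominator of the fraction, so both sides are equal. *)
rewrite le_eqVlt; apply/orP; left; apply/eqP.
by rewrite exprS; field; rewrite -(natrD R 2 m) pnatr_eq0.
Qed.

Section Means.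
Variable R : realType.
Implicit Types n : nat.

Lemma arith_mean_gt0 n (x : 'I_n -> R) :
  (0 < n)%N -> (forall i, 0 < x i) -> 0 < arith_mean x.
Proof.
case: n x => // m x _ x0; rewrite mulr_gt0 ?invr_gt0 ?ltr0n //.
by rewrite big_ord_recl ltr_pwDl // sumr_ge0 // => i _; exact: ltW.
Qed.

(** Turns a mean into an [n]-th root, so that monotonicity of the root reduces bounds on [geom_mean]
    to bounds on the product. *)
Lemma powR_expr_invn n (a : R) : (0 < n)%N -> 0 <= a -> (a ^+ n) `^ n%:R^-1 = a.
Proof.
move=> n0 a0; rewrite -powR_mulrn // -powRrM divff ?powRr1 //.
by rewrite pnatr_eq0 -lt0n.
Qed.

Lemma geom_mean_le_arith_mean n (x : 'I_n -> R) :
  (0 < n)%N -> (forall i, 0 < x i) -> geom_mean x <= arith_mean x.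
Proof.
move=> n0 x0; have A0 := ltW (arith_mean_gt0 n0 x0).
rewrite -[leRHS](powR_expr_invn n0 A0) ge0_ler_powR ?invr_ge0 ?nnegrE //.
- by apply: prodr_ge0 => i _; exact: ltW.
- exact: exprn_ge0.
- exact: prod_le_mean_exp.
Qed.

Lemma powRVl (a r : R) : 0 <= a -> a^-1 `^ r = (a `^ r)^-1.
Proof.
by move=> a0; rewrite -(powR_inv1 a0) -(powR_inv1 (powR_ge0 a r)) -!powRrM mulrC.
Qed.

Lemma geom_mean_inv n (x : 'I_n -> R) :
  (forall i, 0 < x i) -> geom_mean (fun i => (x i)^-1) = (geom_mean x)^-1.
Proof.
move=> x0; have P0 : 0 <= \prod_(i < n) x i by apply: prodr_ge0 => i _; exact: ltW.
by rewrite /geom_mean prodfV powRVl.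
Qed.

Lemma geom_mean_gt0 n (x : 'I_n -> R) :
  (forall i, 0 < x i) -> 0 < geom_mean x.
Proof. by move=> x0; rewrite powR_gt0 // prodr_gt0. Qed.

Lemma harm_mean_inv n (x : 'I_n -> R) :
  harm_mean (fun i => (x i)^-1) = (arith_mean x)^-1.
Proof. by rewrite /harm_mean; under eq_bigr do rewrite invrK. Qed.

Lemma harm_mean_gt0 n (x : 'I_n -> R) :
  (0 < n)%N -> (forall i, 0 < x i) -> 0 < harm_mean x.
Proof.
by move=> n0 x0; rewrite invr_gt0 arith_mean_gt0 // => i; rewrite invr_gt0.
Qed.

(** The geometric mean lies between the two: AM-GM for the inverses reads [G^-1 <= H^-1]. *)
Lemma harm_mean_le_arith_mean n (x : 'I_n -> R) :
  (0 < n)%N -> (forall i, 0 < x i) -> harm_mean x <= arith_mean x.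
Proof.
move=> n0 x0; have y0 i : 0 < (x i)^-1 by rewrite invr_gt0.
apply: le_trans (geom_mean_le_arith_mean n0 x0).
have := geom_mean_le_arith_mean n0 y0; rewrite geom_mean_inv // => le.
rewrite -[leRHS]invrK lef_pV2 ?posrE ?invr_gt0 ?geom_mean_gt0 //.
exact: arith_mean_gt0.
Qed.

Lemma geom_mean_le n (x : 'I_n -> R) :
  (0 < n)%N -> (forall i, 0 < x i) ->
  geom_mean x <= (harm_mean x / arith_mean x) `^ n%:R^-1 * arith_mean x.
Proof.
case: n x => // m x n0 x0.
have A0 := arith_mean_gt0 n0 x0; have H0 := harm_mean_gt0 n0 x0.
set A := arith_mean x in A0 *; set H := harm_mean x in H0 *.
rewrite -[X in _ <= _ * X](powR_expr_invn n0 (ltW A0)).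
have HA0 : 0 <= H / A by rewrite divr_ge0 ?ltW.
rewrite -powRM ?exprn_ge0 //; last exact: ltW.
have P0 : 0 <= \prod_(i < m.+1) x i by apply: prodr_ge0 => i _; exact: ltW.
rewrite /geom_mean ge0_ler_powR ?invr_ge0 ?nnegrE //.
  by apply: ltW; rewrite mulr_gt0 ?divr_gt0 ?exprn_gt0.
(* Under the root, with [n = m+1], the right-hand side is [(H / A) A^n = H A^m]; dividing by [H]
   brings in the sum of inverses. *)
rewrite exprS mulrA divfK ?gt_eqF // mulrC -ler_pdivrMr //.
rewrite /H /harm_mean invrK mulrCA mulrC ler_pdivrMr ?ltr0n // [leRHS]mulrC.
exact: prod_sum_inv_le.
Qed.

End Means.

Theorem theorem2p1 (R : realType) (n : nat) (x : 'I_n -> R)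
    (hn : (0 < n)%N) (hx : forall i : 'I_n, 0 < x i) :
  let A := arith_mean x in
  let G := geom_mean x in
  let H := harm_mean x in
  [/\ H <= H * (A / H) `^ n%:R^-1,
      H * (A / H) `^ n%:R^-1 <= G,
      G <= (H / A) `^ n%:R^-1 * A &
      (H / A) `^ n%:R^-1 * A <= A].
Proof.
move=> A G H.
have y0 i : 0 < (x i)^-1 by rewrite invr_gt0.
have A0 : 0 < A by exact: arith_mean_gt0.
have H0 : 0 < H by exact: harm_mean_gt0.
have leHA : H <= A by exact: harm_mean_le_arith_mean.
have n0 : 0 <= n%:R^-1 :> R by rewrite invr_ge0.
(* Both correction factors are expressed through [r = (H / A)^(1/n)], and [r <= 1] gives the two
   outer inequalities. *)
have powV : (A / H) `^ n%:R^-1 = ((H / A) `^ n%:R^-1)^-1.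
  by rewrite -(invf_div H A) powRVl ?divr_ge0 ?ltW.
have r0 : 0 < (H / A) `^ n%:R^-1 by rewrite powR_gt0 // divr_gt0.
have r1 : (H / A) `^ n%:R^-1 <= 1.
  have le1 : H / A <= 1 by rewrite ler_pdivrMr ?mul1r.
  have := ge0_ler_powR n0 _ _ le1; rewrite powR1 !nnegrE; apply=> //.
  by rewrite divr_ge0 ?ltW.
split.
- by rewrite powV ler_pMr // invf_ge1.
- (* Inversion of the x i exchanges H and A^-1 and turns G into G^-1. *)
  have := geom_mean_le hn y0.
  rewrite geom_mean_inv // harm_mean_inv.
  have -> : arith_mean (fun i => (x i)^-1) = H^-1 by rewrite invrK.
  (* The bound now says [G^-1 <= r / H]; clearing denominators turns it and the goal [H / r <= G]
     into [H <= r G]. *)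
  rewrite invrK [A^-1 * _]mulrC ler_pdivlMr // [leLHS]mulrC.
  rewrite ler_pdivrMr ?geom_mean_gt0 // powV ler_pdivrMr // [leRHS]mulrC.
  exact.
- exact: geom_mean_le.
- by rewrite ger_pMl.
Qed.
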